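(* Assume that $p$, $N$, $d$, $c$ satisfy Condition A or Condition B. Let $g_c(x)=x^d+cx^{d+1}$ and let $\phi_c(x)=x\left(1+\sum_{n\ge1}b_nx^n\right)\in\mathbb{C}_p[[x]]$ be the Böttcher coordinate, i.e. the unique such series with $\phi_c(g_c(x))=\phi_c(x)^d$ (equivalently $\left(1+\sum_{n\ge1}b_nx^n\right)^d=1+cx+\sum_{n\ge1}b_nx^{nd}(1+cx)^{n+1}$). Let $\phi_c^{-1}$ be its compositional inverse. Then the maximal convergent open disks of $\phi_c(x)$ and $\phi_c^{-1}(x)$ are both $D(0,r_N^{-1})=\{x\in\mathbb{C}_p:|x|_p<r_N^{-1}\}$, where $r_N=\left(|c/d^{N+1}|_p\,p^{1/(p-1)}\right)^{1/d^N}>1$. Moreover, $\phi_c$ is a bijective isometry from $D(0,r_N^{-1})$ onto itself.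
   Context: Let $p$ be a prime, $\mathbb{C}_p$ the completion of an algebraic closure of $\mathbb{Q}_p$, $v_p$ the valuation with $v_p(p)=1$, $|x|_p=p^{-v_p(x)}$. Let $d\ge2$ be an integer and $c\in\mathbb{C}_p$. Condition A: $N=0$, $d$ is a multiple of $p$, and $v_p(c)<v_p(d)+\frac{v_p((d-1)!)}{d-1}$. Condition B: $N\ge1$ is an integer, $d$ is a power of $p$, and $Nv_p(d)+\frac{v_p((d-1)!)}{d-1}<v_p(c)<(N+1)v_p(d)+\frac{v_p((d-1)!)}{d-1}$. The maximal convergent open disk of a power series in $x$ is the open disk $D(0,R)$ where $R$ is its radius of convergence. *)

(* Defs.v *)
From HB Require Import structures.
From mathcomp Require Import all_boot all_order all_algebra.
From mathcomp Require Import all_classical all_reals all_analysis.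
Set Implicit Arguments. Unset Strict Implicit. Unset Printing Implicit Defensive.
Import Order.TTheory GRing.Theory Num.Theory.
Local Open Scope ring_scope.
Local Open Scope classical_set_scope.

(* absv is a nonarchimedean absolute value with |p| = 1/p for which K is
   complete; K is moreover taken algebraically closed (closedFieldType).      *)
Definition Cp_abs (R : realType) (K : fieldType) (p : nat) (absv : K -> R)
  : Prop :=
  prime p /\
  (forall x, 0 <= absv x) /\
  (forall x, absv x = 0 <-> x = 0) /\
  (forall x y, absv (x * y) = absv x * absv y) /\
  (forall x y, absv (x + y) <= Num.max (absv x) (absv y)) /\
  absv (p%:R) = (p%:R)^-1 /\
  (forall u : nat -> K,
     (forall eps, 0 < eps -> exists M, forall m n, (M <= m)%N -> (M <= n)%N ->
        absv (u m - u n) < eps) ->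
     exists l, forall eps, 0 < eps -> exists M, forall m, (M <= m)%N ->
        absv (u m - l) < eps).

(* p-adic valuation v_p(x) = - log_p |x|_p  (meaningful for x <> 0) *)
Definition vp (R : realType) (K : fieldType) (p : nat) (absv : K -> R) (x : K)
  : R := - ln (absv x) / ln (p%:R).

(* Condition A (the constraint v_p(c) < ... forces c <> 0, v_p(0) = +oo) *)
Definition condA (R : realType) (K : fieldType) (p : nat) (absv : K -> R)
  (N d : nat) (c : K) : Prop :=
  N = 0%N /\ (p %| d)%N /\ c != 0 /\
  vp p absv c < vp p absv (d%:R) + vp p absv ((d.-1)`!%:R) / (d.-1)%:R.

(* Condition B (the upper bound on v_p(c) forces c <> 0) *)
Definition condB (R : realType) (K : fieldType) (p : nat) (absv : K -> R)
  (N d : nat) (c : K) : Prop :=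
  (1 <= N)%N /\ (exists k, d = (p ^ k)%N) /\ c != 0 /\
  N%:R * vp p absv (d%:R) + vp p absv ((d.-1)`!%:R) / (d.-1)%:R
    < vp p absv c /\
  vp p absv c <
    N.+1%:R * vp p absv (d%:R) + vp p absv ((d.-1)`!%:R) / (d.-1)%:R.

Definition trunc (K : fieldType) (a : nat -> K) (m : nat) : {poly K} :=
  \poly_(i < m.+1) a i.

Definition one_plus (K : fieldType) (b : nat -> K) (n : nat) : K :=
  if n == 0%N then 1 else b n.

(* the formal identity
   (1 + sum_{n>=1} b_n x^n)^d = 1 + c x + sum_{n>=1} b_n x^{nd} (1+cx)^{n+1},
   checked coefficientwise: the coefficient of x^k on either side only
   involves b_1..b_k, hence is computed exactly by degree-m truncations,
   m >= k. *)
Definition bottcher_eq (K : fieldType) (d : nat) (c : K) (b : nat -> K)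
  : Prop :=
  forall m k, (k <= m)%N ->
    ((trunc (one_plus b) m) ^+ d)`_k =
    (1 + c *: 'X + \sum_(1 <= n < m.+1)
        b n *: ('X^(n * d) * (1 + c *: 'X) ^+ n.+1))`_k.

Definition phi_coef (K : fieldType) (b : nat -> K) (n : nat) : K :=
  if n == 0%N then 0 else one_plus b n.-1.

(* e is the compositional inverse of the series a (a 0 = 0, a 1 = 1):
   e 0 = 0 and a(e(x)) = x = e(a(x)) as formal power series
   (again coefficientwise, via truncations). *)
Definition comp_inverse (K : fieldType) (a e : nat -> K) : Prop :=
  e 0%N = 0 /\
  (forall m k, (k <= m)%N ->
     (trunc a m \Po trunc e m)`_k = (k == 1%N)%:R) /\
  (forall m k, (k <= m)%N ->
     (trunc e m \Po trunc a m)`_k = (k == 1%N)%:R).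

Definition conv_radius (R : realType) (K : fieldType) (absv : K -> R)
  (a : nat -> K) : \bar R :=
  ereal_sup ((fun r : R => r%:E) @`
    [set r : R | 0 <= r /\ exists M : R, forall n, absv (a n) * r ^+ n <= M]).

Definition series_conv_to (R : realType) (K : fieldType) (absv : K -> R)
  (a : nat -> K) (x l : K) : Prop :=
  forall eps, 0 < eps -> exists M, forall m, (M <= m)%N ->
    absv (\sum_(i < m) a i * x ^+ i - l) < eps.

Definition rN (R : realType) (K : fieldType) (p : nat) (absv : K -> R)
  (N d : nat) (c : K) : R :=
  (absv (c / (d%:R) ^+ N.+1) * (p%:R `^ (p.-1%:R)^-1)) `^ ((d ^ N)%N%:R)^-1.

(* Main.v *)
(* Iterating [(1 + B)^d = (1 + c x) (1 + B(g))], with [1 + B = phi / x], gives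
   the product [1 + B = \prod_j F_j] where [F_j = (1 + c g^j)^(1/d^(j+1))] and
   [g^j] is the [j]-th iterate, close to [x^(d^j)].  Write
   [theta = p^(-1/(p-1))].  By Legendre's formula [|n!| >= theta^(n-1)], with
   equality at powers of [p]; hence on the disk of radius [1/r] the Gauss norm
   of [F_j - 1] is at most [ht j = |c / d^(j+1)| r^(-d^j)].  Conditions A and B
   say that [ht j] is maximal at [j = N] only, where it equals [theta].  So
   [|b_n| <= theta r^n], with equality at [n = d^N p^m] because there the factor
   [F_N] dominates.  This gives the radius of [phi]; as [theta < 1], [phi]
   differs from the identity by a [theta]-contraction, which makes it a
   bijective isometry; and the bound transfers to the inverse series. *)
Require Import Defs.
From HB Require Import structures.
From mathcomp Require Import all_boot all_order all_algebra.
From mathcomp Require Import all_classical all_reals all_analysis.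
From mathcomp Require Import ring lra zify.
Set Implicit Arguments. Unset Strict Implicit.
Import Order.TTheory GRing.Theory Num.Theory.
Local Open Scope ring_scope.

(** * Factorials and the absolute value *)

(** In Legendre's formula, [p * (n %/ p^(k+1)) <= n %/ p^k] bounds the sum by a telescoping one; the
    quotient at the largest [t] with [p^t <= n] is at least 1, whence the [-1]. *)
Lemma logn_fact_le (p n : nat) : prime p -> (0 < n)%N ->
  (p.-1 * logn p n`! <= n.-1)%N.
Proof.
move=> p_pr n_gt0; have p_gt1 := prime_gt1 p_pr.
have part m : (p.-1 * \sum_(1 <= k < m.+1) n %/ p ^ k <= n - n %/ p ^ m)%N.
  elim: m => [|m IHm]; first by rewrite big_geq // muln0.
  rewrite big_nat_recr //= mulnDr.
  have: (n %/ p ^ m.+1 * p <= n %/ p ^ m)%N.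
    by rewrite expnSr divnMA leq_divM.
  have := leq_div n (p ^ m); move: IHm; nia.
pose t := trunc_log p n.
have t_lt : (t < n)%N by apply: leq_trans (ltn_expl t p_gt1) (trunc_logP _ _).
rewrite logn_fact // (@big_cat_nat _ _ _ t.+1) //=; last exact: ltnW.
have -> : (\sum_(t.+1 <= k < n.+1) n %/ p ^ k = 0)%N.
  rewrite big_nat; apply: big1 => k /andP[tk _]; apply: divn_small.
  by apply: leq_trans (trunc_log_ltn n p_gt1) _; rewrite leq_exp2l.
rewrite addn0.
have := part t; have : (0 < n %/ p ^ t)%N.
  by rewrite divn_gt0 ?expn_gt0 ?prime_gt0 // trunc_logP.
lia.
Qed.

(** The divisions by [p^i], [i <= m], are now exact, so the telescoping loses nothing; only the
    lower bound remains to be shown. *)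
Lemma logn_fact_exp (p m : nat) : prime p ->
  (p.-1 * logn p (p ^ m)`! = (p ^ m).-1)%N.
Proof.
move=> p_pr; apply/eqP; rewrite eqn_leq logn_fact_le ?expn_gt0 ?prime_gt0 //=.
have p_gt1 := prime_gt1 p_pr.
have part k : (k <= m)%N ->
    (p ^ m - p ^ (m - k) <= p.-1 * \sum_(1 <= i < k.+1) p ^ m %/ p ^ i)%N.
  elim: k => [|k IHk] km; first by rewrite subn0 subnn.
  rewrite big_nat_recr //= mulnDr -expnB ?prime_gt0 //.
  have := IHk (ltnW km); rewrite -(subnSK km) expnS.
  have : (p ^ (m - k.+1) <= p ^ m)%N by rewrite leq_exp2l // leq_subr.
  by move: (p ^ (m - k.+1))%N => a; nia.
rewrite logn_fact // (@big_cat_nat _ _ _ m.+1) //=; last first.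
  by rewrite ltnS ltnW // ltn_expl.
have := part m (leqnn m); rewrite subnn; nia.
Qed.

Section AbsoluteValue.
Variables (R : realType) (K : fieldType) (p : nat) (absv : K -> R).
Hypothesis absvP : Cp_abs p absv.

Lemma Cp_prime : prime p. Proof. by case: absvP. Qed.

Lemma absv_ge0 x : 0 <= absv x. Proof. by case: absvP => _ []. Qed.

Lemma absv_eq0 x : (absv x == 0) = (x == 0).
Proof. by case: absvP => _ [_ [h _]]; apply/eqP/eqP => /h. Qed.

Lemma absvM x y : absv (x * y) = absv x * absv y.
Proof. by case: absvP => _ [_ [_ [h _]]]. Qed.

Lemma absv_p : absv p%:R = p%:R^-1.
Proof. by case: absvP => _ [_ [_ [_ [_ []]]]]. Qed.

Lemma Cp_complete (u : nat -> K) :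
  (forall eps, 0 < eps -> exists M, forall m n, (M <= m)%N -> (M <= n)%N ->
     absv (u m - u n) < eps) ->
  exists l, forall eps, 0 < eps -> exists M, forall m, (M <= m)%N ->
     absv (u m - l) < eps.
Proof. by case: absvP => _ [_ [_ [_ [_ [_]]]]]; apply. Qed.

Lemma absv0 : absv 0 = 0. Proof. by apply/eqP; rewrite absv_eq0. Qed.

Lemma absv_gt0 x : (0 < absv x) = (x != 0).
Proof. by rewrite lt_def absv_eq0 absv_ge0 andbT. Qed.

Lemma absv1 : absv 1 = 1.
Proof.
have : absv 1 * absv 1 = absv 1 * 1 by rewrite -absvM !mulr1.
by apply: mulfI; rewrite absv_eq0 oner_eq0.
Qed.

Lemma absvX x n : absv (x ^+ n) = absv x ^+ n.
Proof. by elim: n => [|n IHn]; rewrite ?absv1 // !exprS absvM IHn. Qed.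

Lemma absvV x : absv x^-1 = (absv x)^-1.
Proof.
have [->|x0] := eqVneq x 0; first by rewrite invr0 absv0 invr0.
by apply: (mulfI (x := absv x)); rewrite -?absvM ?divff ?absv1 ?absv_eq0.
Qed.

Lemma absvN x : absv (- x) = absv x.
Proof.
apply: (pexpIrn (n := 2)) => //; rewrite ?nnegrE ?absv_ge0 //.
by rewrite -!absvX sqrrN.
Qed.

Lemma absvBC x y : absv (x - y) = absv (y - x).
Proof. by rewrite -absvN opprB. Qed.

Lemma absvD_le x y h : absv x <= h -> absv y <= h -> absv (x + y) <= h.
Proof.
case: absvP => _ [_ [_ [_ [tri _]]]] hx hy.
by apply: le_trans (tri x y) _; rewrite ge_max hx.
Qed.

Lemma absvD_lt x y h : absv x < h -> absv y < h -> absv (x + y) < h.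
Proof.
case: absvP => _ [_ [_ [_ [tri _]]]] hx hy.
by apply: le_lt_trans (tri x y) _; rewrite gt_max hx.
Qed.

Lemma absvB_le x y h : absv x <= h -> absv y <= h -> absv (x - y) <= h.
Proof. by move=> ? ?; apply: absvD_le; rewrite ?absvN. Qed.

Lemma absvB_lt x y h : absv x < h -> absv y < h -> absv (x - y) < h.
Proof. by move=> ? ?; apply: absvD_lt; rewrite ?absvN. Qed.

(** If [|x + y| < |x|], then [x = (x + y) - y] would be smaller than itself. *)
Lemma absvD_dom x y : absv y < absv x -> absv (x + y) = absv x.
Proof.
move=> yx; apply/eqP; rewrite eq_le (absvD_le (lexx _) (ltW yx)) leNgt.
apply/negP => xyx; suff: absv x < absv x by rewrite ltxx.
by rewrite -{1}(addrK y x); apply: absvB_lt.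
Qed.

Lemma absv_sum_le (I : Type) (s : seq I) (P : pred I) (F : I -> K) h :
  0 <= h -> (forall i, P i -> absv (F i) <= h) ->
  absv (\sum_(i <- s | P i) F i) <= h.
Proof.
move=> h0 Fh; apply: (big_ind (fun x => absv x <= h)) => //.
  by rewrite absv0.
by move=> x y; apply: absvD_le.
Qed.

Lemma absv_nat_le1 n : absv n%:R <= 1.
Proof.
elim: n => [|n IHn]; first by rewrite absv0 ler01.
by rewrite -natr1; apply: absvD_le; rewrite ?absv1.
Qed.

Lemma p_gt1R : 1 < p%:R :> R.
Proof. by rewrite ltr1n prime_gt1 ?Cp_prime. Qed.

(** Bezout gives [u n = 1 + v p] with [|v p| < 1]; so [|u n| = 1], and neither factor exceeds 1. *)
Lemma absv_nat_coprime n : (0 < n)%N -> coprime n p -> absv n%:R = 1.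
Proof.
move=> n0 /(coprimeP _ n0)[[u v] /= uv].
have uv1 : (u * n = 1 + v * p)%N by move: uv; clear; lia.
have: absv (u * n)%:R = 1.
  rewrite uv1 natrD absvD_dom absv1 // natrM absvM absv_p.
  rewrite -[ltRHS]mulr1; apply: (@le_lt_trans _ _ (1 * p%:R^-1)).
    by rewrite ler_wpM2r ?absv_nat_le1 // invr_ge0 ler0n.
  by rewrite !mul1r invf_lt1 ?p_gt1R // (lt_trans ltr01) ?p_gt1R.
rewrite natrM absvM => un; apply/eqP; rewrite eq_le absv_nat_le1 /= -{1}un.
by rewrite ler_piMl ?absv_ge0 ?absv_nat_le1.
Qed.

Lemma absv_nat n : (0 < n)%N -> absv n%:R = p%:R^-1 ^+ logn p n.
Proof.
move=> n0; have p_pr := Cp_prime.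
rewrite -{1}(partnC p n0) natrM absvM p_part natrX absvX absv_p.
rewrite [X in _ * X]absv_nat_coprime ?mulr1 //.
by rewrite coprime_sym prime_coprime // -p'natE // part_pnat.
Qed.

Lemma Cp_nat_neq0 n : (0 < n)%N -> n%:R != 0 :> K.
Proof.
move=> n0; rewrite -absv_gt0 absv_nat // exprn_gt0 // invr_gt0.
exact: lt_trans ltr01 p_gt1R.
Qed.

(** Normalised by [theta^(p-1) = |p|], so that [|n!|] is [theta] to the power [(p-1) v_p(n!)], the
    quantity that Legendre's formula controls. *)
Definition theta : R := (p%:R `^ (p.-1%:R)^-1)^-1.

Lemma p1_gt0 : (0 < p.-1)%N.
Proof. by rewrite -ltnS prednK ?prime_gt0 ?prime_gt1 ?Cp_prime. Qed.

Lemma theta_gt0 : 0 < theta.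
Proof. by rewrite invr_gt0 powR_gt0 // (lt_trans ltr01) ?p_gt1R. Qed.

Lemma thetaX : theta ^+ p.-1 = p%:R^-1.
Proof.
rewrite exprVn -powR_mulrn ?powR_ge0 // -powRrM mulVf ?powRr1 //.
by rewrite pnatr_eq0 -lt0n p1_gt0.
Qed.

Lemma theta_lt1 : theta < 1.
Proof.
rewrite ltNge; apply/negP => /(exprn_ege1 p.-1); rewrite thetaX leNgt.
by rewrite invf_lt1 ?p_gt1R // (lt_trans ltr01) ?p_gt1R.
Qed.

Lemma absv_natE n : (0 < n)%N -> absv n%:R = theta ^+ (p.-1 * logn p n).
Proof. by move=> n0; rewrite absv_nat // exprM thetaX. Qed.

Lemma absv_fact_ge n : (0 < n)%N -> theta ^+ n.-1 <= absv n`!%:R.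
Proof.
move=> n0; rewrite absv_natE ?fact_gt0 //.
apply: ler_wiXn2l; rewrite ?ltW ?theta_gt0 ?theta_lt1 //.
by rewrite logn_fact_le ?Cp_prime.
Qed.

Lemma absv_fact_exp m : absv (p ^ m)`!%:R = theta ^+ (p ^ m).-1.
Proof. by rewrite absv_natE ?fact_gt0 // logn_fact_exp ?Cp_prime. Qed.

End AbsoluteValue.

(** * Congruence modulo [X^M] and roots of [1 + X] *)

Section TruncatedSeries.
Variable K : fieldType.
Implicit Types (f g h : {poly K}) (M n D : nat).

Definition eqm M f g := 'X^M %| f - g.

Lemma eqmP M f g :
  reflect (forall i, (i < M)%N -> f`_i = g`_i) (eqm M f g).
Proof.
apply: (iffP idP) => [/dvdpP[q fg] i iM|fg].
  by apply/eqP; rewrite -subr_eq0 -coefB fg coefMXn iM.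
have take0 : take_poly M (f - g) = 0.
  apply/polyP => i; rewrite coef_take_poly coef0.
  by case: ifP => // iM; rewrite coefB fg // subrr.
rewrite /eqm -(poly_take_drop M (f - g)) take0 add0r.
by rewrite dvdp_mull.
Qed.

Lemma eqm_refl M f : eqm M f f. Proof. by rewrite /eqm subrr dvdp0. Qed.

Lemma eqm_sym M f g : eqm M f g -> eqm M g f.
Proof. by rewrite /eqm -opprB dvdpNr. Qed.

Lemma eqm_trans M f g h : eqm M f g -> eqm M g h -> eqm M f h.
Proof. by rewrite /eqm => fg gh; rewrite -(subrKA g) dvdp_add. Qed.

Lemma eqmM M f f' g g' : eqm M f f' -> eqm M g g' -> eqm M (f * g) (f' * g').
Proof.
rewrite /eqm => ff gg; have -> : f * g - f' * g' = f * (g - g') + (f - f') * g'.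
  by ring.
by apply: dvdp_add; [apply: dvdp_mull | apply: dvdp_mulr].
Qed.

Lemma eqmX M n f g : eqm M f g -> eqm M (f ^+ n) (g ^+ n).
Proof.
by move=> fg; elim: n => [|n IHn]; rewrite ?eqm_refl // !exprS eqmM.
Qed.

(** [X^M] composed with [h] is [h^M], a multiple of [X^M]. *)
Lemma eqm_comp M f g h : 'X %| h -> eqm M f g -> eqm M (f \Po h) (g \Po h).
Proof.
rewrite /eqm -comp_polyB => Xh /dvdpP[q ->].
by rewrite comp_polyM comp_Xn_poly dvdp_mull ?dvdp_exp2r.
Qed.

(* The cofactor [\sum f^i g^(D-1-i)] of [f - g] has constant term [D]. *)
Lemma eqm_root M D f g : D%:R != 0 :> K ->
  f`_0 = 1 -> g`_0 = 1 -> eqm M (f ^+ D) (g ^+ D) -> eqm M f g.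
Proof.
rewrite /eqm subrXX => D0 f0 g0; rewrite Gauss_dvdpl //.
apply: coprimep_expl; rewrite coprimep_sym coprimepX /root.
rewrite -!horner_coef0 in f0 g0.
rewrite horner_sum (eq_bigr (fun=> 1)) ?sumr_const ?card_ord //.
by move=> i _; rewrite hornerM !horner_exp f0 g0 !expr1n mulr1.
Qed.

Lemma comp_poly_def n (E : nat -> K) h :
  (\poly_(i < n) E i) \Po h = \sum_(i < n) E i *: h ^+ i.
Proof.
rewrite poly_def (@linear_sum _ _ _ _ (comp_poly h)); apply: eq_bigr => i _.
by rewrite /= comp_polyZ comp_Xn_poly.
Qed.

(** The coefficient of [X^n] in the binomial series of [(1 + X)^(1/D)]. *)
Definition binom_root D n : K :=
  (\prod_(i < n) (D%:R^-1 - i%:R)) / n`!%:R.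

Lemma binom_root0 D : binom_root D 0 = 1.
Proof. by rewrite /binom_root big_ord0 divr1. Qed.

Definition root_poly D M : {poly K} := \poly_(i < M.+1) binom_root D i.

(* Both sides solve [(1 + X) y' = y] up to order [M]. *)
Lemma root_polyX D M : (forall n, (0 < n)%N -> n%:R != 0 :> K) -> (0 < D)%N ->
  eqm M.+1 (root_poly D M ^+ D) (1 + 'X).
Proof.
move=> char0 D0; set f := root_poly D M.
(* Differentiating the truncation costs one order, hence the modulus [X^M]. *)
have odef : eqm M (D%:R%:P * ((1 + 'X) * f^`())) f.
  apply/eqmP => i iM; rewrite coefCM mulrDl mul1r coefD coefXM !coef_deriv.
  have fE k : (k <= M)%N -> f`_k = binom_root D k.
    by move=> kM; rewrite coef_poly ltnS kM.
  have -> : (if i == 0%N then 0 else f`_i.-1.+1 *+ i.-1.+1) = f`_i *+ i.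
    by case: (i).
  rewrite !fE // ?(ltnW iM) //.
  have -> : binom_root D i.+1 =
      binom_root D i * ((D%:R^-1 - i%:R) / i.+1%:R).
    rewrite /binom_root big_ord_recr /= factS natrM invfM.
    by rewrite [_ / i.+1%:R]mulrC; ring.
  rewrite -[X in X + _]mulr_natr -[X in _ + X]mulr_natr; field.
  by rewrite -(natrD _ 1 i) !char0.
have odeh : eqm M ((1 + 'X) * (f ^+ D)^`()) (f ^+ D).
  have -> : (1 + 'X) * (f ^+ D)^`() =
      f ^+ D.-1 * (D%:R%:P * ((1 + 'X) * f^`())).
    by rewrite deriv_exp -mulr_natl -[D%:R]polyC_natr; ring.
  have -> : f ^+ D = f ^+ D.-1 * f by rewrite -exprSr prednK.
  by apply: eqmM => //; apply: eqm_refl.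
(* For [h = f^D] the equation reads [(i+1) h_(i+1) = (1 - i) h_i]; with [h_0 = 1] this forces the
   coefficients [1, 1, 0, 0, ...]. *)
apply/eqmP => i; elim: i => [_|i IHi iM].
  rewrite -!horner_coef0 horner_exp hornerD hornerC hornerX addr0.
  by rewrite horner_coef0 coef_poly /= binom_root0 expr1n.
move/eqmP/(_ i iM): odeh; rewrite mulrDl mul1r coefD coefXM !coef_deriv.
have -> : (if i == 0%N then 0 else (f ^+ D)`_i.-1.+1 *+ i.-1.+1) =
    (f ^+ D)`_i *+ i by case: (i).
rewrite IHi 1?ltnW // => eq_i.
apply: (mulIf (char0 i.+1 isT)); move: eq_i.
rewrite !coefD !coef1 !coefX -[X in X + _ = _]mulr_natr -[X in _ + X = _]mulr_natr.
case: i {IHi iM} => [|[|i]] /=.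
- by move=> e; rewrite -[LHS](addrK ((1 + 0) * 0%:R)) e; ring.
- by move=> e; rewrite -[LHS](addrK ((0 + 1) * 1%:R)) e; ring.
by move=> e; rewrite -[LHS](addrK ((0 + 0) * i.+2%:R)) e; ring.
Qed.

End TruncatedSeries.

(** * Coefficients of the Boettcher coordinate *)

Section GaussNorm.
Variables (R : realType) (K : fieldType) (p : nat) (absv : K -> R).
Hypothesis absvP : Cp_abs p absv.
Variable r : R.
Hypothesis r_gt0 : 0 < r.
Implicit Types (f g : {poly K}) (h : R).

(* The Gauss norm of [f] on the disk of radius [1/r] is at most [h]. *)
Definition bnd h f := forall i, absv f`_i <= h * r ^+ i.

Lemma bndW h h' f : h <= h' -> bnd h f -> bnd h' f.
Proof.
move=> hh' hf i; apply: le_trans (hf i) _.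
by rewrite ler_wpM2r // exprn_ge0 // ltW.
Qed.

Lemma bnd0 h : 0 <= h -> bnd h 0.
Proof.
by move=> h0 i; rewrite coef0 (absv0 absvP) mulr_ge0 // exprn_ge0 // ltW.
Qed.

Lemma bndD h f g : bnd h f -> bnd h g -> bnd h (f + g).
Proof. by move=> hf hg i; rewrite coefD (absvD_le absvP). Qed.

Lemma bndM h h' f g : 0 <= h -> 0 <= h' -> bnd h f -> bnd h' g ->
  bnd (h * h') (f * g).
Proof.
move=> h0 h0' hf hg i; rewrite coefM; apply: (absv_sum_le absvP).
  by rewrite !mulr_ge0 // exprn_ge0 // ltW.
move=> j _; rewrite (absvM absvP).
have -> : r ^+ i = r ^+ j * r ^+ (i - j) by rewrite -exprD subnKC // -ltnS.
rewrite mulrACA.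
by rewrite ler_pM ?(absv_ge0 absvP).
Qed.

Lemma bnd_sum h (I : Type) (s : seq I) (P : pred I) (F : I -> {poly K}) :
  0 <= h -> (forall i, P i -> bnd h (F i)) ->
  bnd h (\sum_(i <- s | P i) F i).
Proof.
move=> h0 hF; apply: (big_ind (bnd h)) => //; first exact: bnd0.
by move=> f g; apply: bndD.
Qed.

Lemma bndZ h a f : bnd h f -> bnd (absv a * h) (a *: f).
Proof.
move=> hf i; rewrite coefZ (absvM absvP) -mulrA.
by rewrite ler_wpM2l ?(absv_ge0 absvP).
Qed.

Lemma bnd1 : bnd 1 1.
Proof.
move=> i; rewrite coef1 mul1r.
by case: i => [|i]; rewrite ?(absv1 absvP) // (absv0 absvP) exprn_ge0 // ltW.
Qed.

Lemma bndXn n : bnd (r ^- n) 'X^n.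
Proof.
move=> i; rewrite coefXn; case: eqP => [->|_].
  by rewrite (absv1 absvP) mulVf // expf_neq0 // gt_eqF.
by rewrite (absv0 absvP) mulr_ge0 ?invr_ge0 ?exprn_ge0 // ltW.
Qed.

Lemma bnd_exp f n : bnd 1 f -> bnd 1 (f ^+ n).
Proof.
move=> hf; elim: n => [|n IHn]; first exact: bnd1.
by rewrite exprS; have := bndM ler01 ler01 hf IHn; rewrite mulr1.
Qed.

Lemma bnd_unit h f : h <= 1 -> bnd h (f - 1) -> bnd 1 f.
Proof.
move=> h1 hf; rewrite -(subrK 1 f); apply: bndD; last exact: bnd1.
exact: bndW hf.
Qed.

(** [f g - 1 = (f - 1) g + (g - 1)], where [g] has norm at most 1 because [h <= 1]. *)
Lemma bnd_unitM h f g : 0 <= h <= 1 -> bnd h (f - 1) -> bnd h (g - 1) ->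
  bnd h (f * g - 1).
Proof.
move=> /andP[h0 h1] hf hg.
have -> : f * g - 1 = (f - 1) * g + (g - 1) by ring.
apply: bndD => //; rewrite -(mulr1 h); apply: bndM => //.
exact: bnd_unit hg.
Qed.

Lemma bnd_unitX h f n : 0 <= h <= 1 -> bnd h (f - 1) -> bnd h (f ^+ n - 1).
Proof.
move=> h01 hf; elim: n => [|n IHn].
  by rewrite subrr; apply: bnd0; case/andP: h01.
by rewrite exprS; apply: bnd_unitM.
Qed.

End GaussNorm.

(** * Iterates of [g] and sizes of the factors *)

Section Coefficients.
Variables (R : realType) (K : fieldType) (p : nat) (absv : K -> R).
Hypothesis absvP : Cp_abs p absv.
Variables (N d : nat) (c : K) (r : R).
Let A := absv d%:R.
Let t := theta R p.
Hypothesis d_gt1 : (1 < d)%N.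
Hypothesis p_dvd_d : (p %| d)%N.
Hypothesis r_gt1 : 1 < r.
(** [absv_c] is the definition of [r] solved for [|c|]. [r_lower] and [r_upper] say that [ht] falls
    from [N] to [N+1] and rises from [N-1] to [N]; [c_lt_r] keeps the iterates of [g] close to
    monomials. *)
Hypothesis absv_c : absv c = t * r ^+ (d ^ N) * A ^+ N.+1.
Hypothesis r_lower : 1 < A * r ^+ (d ^ N * d.-1).
Hypothesis r_upper : N = 0%N \/ A * r ^+ (d ^ N.-1 * d.-1) < 1.
Hypothesis c_lt_r : absv c < r.

Let d_gt0 : (0 < d)%N := ltnW d_gt1.
Let r_gt0 : 0 < r := lt_trans ltr01 r_gt1.
Let t_gt0 : 0 < t := theta_gt0 absvP.
Let t_lt1 : t < 1 := theta_lt1 absvP.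

Let A_gt0 : 0 < A.
Proof. by rewrite (absv_gt0 absvP) (Cp_nat_neq0 absvP). Qed.

Lemma absv_dvd_lt1 D : (0 < D)%N -> (p %| D)%N -> absv D%:R < 1.
Proof.
move=> D0 /dvdnP[k ->]; rewrite natrM (absvM absvP) (absv_p absvP).
have p1 := p_gt1R absvP; have p0 : 0 < p%:R :> R := lt_trans ltr01 p1.
apply: (@le_lt_trans _ _ (1 * p%:R^-1)); last by rewrite mul1r invf_lt1.
by rewrite ler_wpM2r ?(absv_nat_le1 absvP) // invr_ge0 ltW.
Qed.

(** As [p] divides [D], [|1/D| > 1 >= |i|]; so every factor [1/D - i] has absolute value [|1/D|]. *)
Lemma absv_binom_root D n : (0 < D)%N -> (p %| D)%N ->
  absv (binom_root K D n) = (absv D%:R)^-1 ^+ n / absv n`!%:R.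
Proof.
move=> D0 pD; rewrite /binom_root (absvM absvP) (absvV absvP); congr (_ / _).
elim: n => [|n IHn]; first by rewrite big_ord0 expr0 (absv1 absvP).
rewrite big_ord_recr /= (absvM absvP) IHn exprSr; congr (_ * _).
rewrite (absvD_dom absvP) (absvV absvP) // (absvN absvP).
apply: le_lt_trans (absv_nat_le1 absvP n) _.
rewrite invf_gt1 ?absv_dvd_lt1 // (absv_gt0 absvP) (Cp_nat_neq0 absvP) //.
Qed.

Definition gmap : {poly K} := 'X^d * (1 + c *: 'X).

Fixpoint giter j : {poly K} :=
  if j is j'.+1 then gmap \Po giter j' else 'X.

(** The unit [u_j] in [g^j = x^(d^j) u_j]; the recursion comes from [g(G) = G^d (1 + c G)]. *)
Fixpoint giter_unit j : {poly K} :=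
  if j is j'.+1 then giter_unit j' ^+ d * (1 + c *: giter j') else 1.

Lemma giterE j : giter j = 'X^(d ^ j) * giter_unit j.
Proof.
elim: j => [|j IHj] /=; first by rewrite mulr1 expn0 expr1.
rewrite /gmap comp_polyM comp_Xn_poly comp_polyD comp_polyZ comp_polyX.
rewrite -[1]/(1%:P) comp_polyC {1}IHj exprMn -exprM -expnSr.
by rewrite mulrA.
Qed.

Lemma giter_dvdX j : 'X %| giter j.
Proof.
rewrite giterE dvdp_mulr // -[X in X %| _]expr1 dvdp_exp2l //.
by rewrite expn_gt0 d_gt0.
Qed.

Let delta := absv c / r.

Let delta_ge0 : 0 <= delta.
Proof. by rewrite divr_ge0 ?(absv_ge0 absvP) // ltW. Qed.

Let delta_lt1 : delta < 1.
Proof. by rewrite ltr_pdivrMr // mul1r. Qed.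

(** [c g^j] has Gauss norm at most [|c| r^(-d^j) <= delta], so each recursion step stays within
    [delta] of 1. *)
Lemma bnd_giter_unit j : bnd absv r delta (giter_unit j - 1).
Proof.
have d01 : 0 <= delta <= 1 by rewrite delta_ge0 ltW.
elim: j => [|j IHj] /=; first by rewrite subrr; apply: (bnd0 absvP).
apply: (bnd_unitM absvP) => //; first exact: (bnd_unitX absvP).
rewrite addrC addKr giterE.
have step : absv c * (r ^- (d ^ j) * 1) <= delta.
  rewrite mulr1 ler_wpM2l ?(absv_ge0 absvP) // lef_pV2 ?posrE ?exprn_gt0 //.
  by rewrite -[leLHS]expr1 ler_eXn2l // expn_gt0 d_gt0.
apply: (bndW r_gt0 step); apply: (bndZ absvP).
apply: (bndM absvP) => //; first by rewrite invr_ge0 exprn_ge0 // ltW.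
  exact: (bndXn absvP).
exact: (bnd_unit absvP) (ltW delta_lt1) IHj.
Qed.

Definition ht j := absv c / A ^+ j.+1 / r ^+ (d ^ j).

Lemma ht_ge0 j : 0 <= ht j.
Proof. by rewrite !divr_ge0 ?exprn_ge0 ?(absv_ge0 absvP) // ltW. Qed.

Lemma htN : ht N = t.
Proof.
rewrite /ht absv_c; field.
by rewrite !expf_neq0 // gt_eqF.
Qed.

(** The ratio of consecutive heights grows with [j]. Exceeding 1 at [N] and, if [N > 0], lying below
    1 at [N-1], it puts the only maximum at [N]. *)
Lemma htS j : ht j = ht j.+1 * (A * r ^+ (d ^ j * d.-1)).
Proof.
have -> : r ^+ (d ^ j * d.-1) = r ^+ (d ^ j.+1) / r ^+ (d ^ j).
  rewrite -expfB; last by rewrite ltn_exp2l.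
  by rewrite expnSr -[X in (_ * X - _)%N](prednK d_gt0) mulnS addKn.
rewrite /ht (exprS A j.+1); field.
by rewrite !expf_neq0 // gt_eqF.
Qed.

Lemma ht_lt_after k : ht (N + k.+1) < t.
Proof.
have c_gt0 : 0 < absv c by rewrite absv_c !mulr_gt0 ?exprn_gt0.
have step j : (N <= j)%N -> ht j.+1 < ht j.
  move=> Nj; rewrite (htS j) ltr_pMr ?divr_gt0 ?exprn_gt0 //.
  apply: lt_le_trans r_lower _; rewrite ler_pM2l // ler_eXn2l //.
  by rewrite leq_mul // leq_exp2l.
elim: k => [|k IHk]; first by rewrite addn1 -htN step.
by rewrite addnS; apply: lt_trans IHk; apply: step; rewrite leq_addr.
Qed.

Lemma ht_lt_before j : (j < N)%N -> ht j < t.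
Proof.
move=> jN; case: r_upper => [N0|up]; first by rewrite N0 in jN.
have c_gt0 : 0 < absv c by rewrite absv_c !mulr_gt0 ?exprn_gt0.
have step i : (i < N)%N -> ht i < ht i.+1.
  move=> iN; rewrite (htS i) gtr_pMr ?divr_gt0 ?exprn_gt0 //.
  apply: le_lt_trans up; rewrite ler_pM2l // ler_eXn2l //.
  by rewrite leq_mul // leq_exp2l // -ltnS prednK // (leq_ltn_trans _ iN).
have inc k : (j + k.+1 <= N)%N -> ht j < ht (j + k.+1).
  elim: k => [|k IHk] kN; first by rewrite addn1; apply: step.
  rewrite addnS in kN *; apply: lt_trans (IHk (ltnW kN)) (step _ kN).
by have := inc (N - j.+1)%N; rewrite addnS -addSn subnKC // htN; apply.
Qed.

Lemma ht_lt j : j != N -> ht j < t.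
Proof.
rewrite neq_ltn => /orP[/ht_lt_before //|Nj].
by rewrite -(subnKC Nj) addSnnS ht_lt_after.
Qed.

Lemma ht_le j : ht j <= t.
Proof. by have [->|/ht_lt/ltW//] := eqVneq j N; rewrite htN. Qed.

(** * Truncated factors of the product *)

Variable M : nat.

(** As [X] divides [giter j], cutting the binomial series at [M] leaves [F_j] unchanged modulo
    [X^(M+1)]. *)
Definition factor j := root_poly K (d ^ j.+1) M \Po (c *: giter j).

Definition factor_coef j n : K := binom_root K (d ^ j.+1) n * c ^+ n.

Lemma factorE j : factor j = \sum_(n < M.+1)
  factor_coef j n *: ('X^(d ^ j * n) * giter_unit j ^+ n).
Proof.
rewrite /factor comp_poly_def; apply: eq_bigr => n _.
by rewrite exprZn scalerA giterE exprMn -exprM.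
Qed.

Lemma absv_factor_coef j n :
  absv (factor_coef j n) * r ^- (d ^ j * n) = ht j ^+ n / absv n`!%:R.
Proof.
rewrite /factor_coef (absvM absvP) absv_binom_root ?expn_gt0 ?d_gt0 //; last first.
  by rewrite expnS dvdn_mulr.
rewrite natrX !(absvX absvP) /ht -/A !expr_div_n !exprVn -!exprM; field.
by rewrite !expf_neq0 ?gt_eqF // (absv_gt0 absvP) (Cp_nat_neq0 absvP) ?fact_gt0.
Qed.

(** With [|n!| >= theta^(n-1)] and [ht <= theta]: [ht^n / |n!| <= ht (ht / theta)^(n-1) <= ht]. *)
Lemma factor_coef_le j n : (0 < n)%N ->
  absv (factor_coef j n) * r ^- (d ^ j * n) <= ht j.
Proof.
move=> n0; rewrite absv_factor_coef -{1}(prednK n0) exprS.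
rewrite ler_pdivrMr ?(absv_gt0 absvP) ?(Cp_nat_neq0 absvP) ?fact_gt0 //.
rewrite ler_wpM2l ?ht_ge0 //; apply: le_trans (absv_fact_ge absvP n0).
by rewrite lerXn2r ?nnegrE ?ht_ge0 ?ht_le // ltW.
Qed.

Lemma bnd_factor_term j n f h : (0 < n)%N -> 0 <= h -> bnd absv r h f ->
  bnd absv r (ht j * h) (factor_coef j n *: ('X^(d ^ j * n) * f)).
Proof.
move=> n0 h0 hf.
apply: (@bndW _ _ _ _ r_gt0 (absv (factor_coef j n) * (r ^- (d ^ j * n) * h))).
  by rewrite mulrA ler_wpM2r // factor_coef_le.
apply: (bndZ absvP); apply: (bndM absvP) => //.
  by rewrite invr_ge0 exprn_ge0 // ltW.
exact: (bndXn absvP).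
Qed.

Lemma bnd_giter_unitX j n : bnd absv r 1 (giter_unit j ^+ n).
Proof.
apply: (bnd_exp absvP r_gt0).
exact: (bnd_unit absvP r_gt0 (ltW delta_lt1) (bnd_giter_unit j)).
Qed.

Lemma bnd_factor j : bnd absv r (ht j) (factor j - 1).
Proof.
rewrite factorE big_ord_recl /factor_coef binom_root0 !expr0 muln0 mulr1.
rewrite scale1r expr0 mulr1 addrC addKr; apply: (bnd_sum absvP) => //.
  exact: ht_ge0.
move=> i _; rewrite -[ht j]mulr1; apply: bnd_factor_term => //.
exact: bnd_giter_unitX.
Qed.

Lemma bnd1_factor j : bnd absv r 1 (factor j).
Proof.
apply: (bnd_unit absvP r_gt0 _ (bnd_factor j)).
exact: le_trans (ht_le j) (ltW t_lt1).
Qed.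

(* [factor N] with [g^N] replaced by its leading part [x^(d^N)]. *)
Definition factor_lead :=
  \sum_(n < M.+1) factor_coef N n *: ('X^(d ^ N * n) : {poly K}).

(** The replacement turns [u_N^n] into 1, a change of norm at most [delta]; the term [n = 0] does
    not change. *)
Lemma bnd_factor_lead : bnd absv r (t * delta) (factor N - factor_lead).
Proof.
have td0 : 0 <= t * delta by rewrite mulr_ge0 // ltW.
rewrite factorE -sumrB; apply: (bnd_sum absvP) => // i _.
rewrite -scalerBr -[X in _ - X]mulr1 -mulrBr.
have [->|i0] := posnP i.
  by rewrite expr0 subrr mulr0 scaler0; apply: (bnd0 absvP).
rewrite -htN; apply: bnd_factor_term => //.
apply: (bnd_unitX absvP) (bnd_giter_unit N) => //.
by rewrite delta_ge0 ltW.
Qed.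

(** Only the term [n = p^m] has this degree; there [|n!| = theta^(n-1)] and [ht N = theta], so
    [ht^n / |n!|] is exactly [theta]. *)
Lemma absv_factor_lead m : (p ^ m <= M)%N ->
  absv factor_lead`_(d ^ N * p ^ m) = t * r ^+ (d ^ N * p ^ m).
Proof.
move=> mM; have dN0 : (0 < d ^ N)%N by rewrite expn_gt0 d_gt0.
have -> : factor_lead`_(d ^ N * p ^ m) = factor_coef N (p ^ m).
  rewrite coef_sum (bigD1 (Ordinal (mM : (p ^ m < M.+1)%N))) //=.
  rewrite coefZ coefXn eqxx mulr1 big1 ?addr0 // => i /eqP ne.
  rewrite coefZ coefXn eqn_pmul2l //; case: eqP => [e|_]; last by rewrite mulr0.
  by case: ne; apply/val_inj.
have rn0 : r ^+ (d ^ N * p ^ m) != 0 by rewrite expf_neq0 // gt_eqF.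
apply: (mulIf (invr_neq0 rn0)); rewrite absv_factor_coef htN mulfK //.
have pm0 : (0 < p ^ m)%N by rewrite expn_gt0 prime_gt0 // (Cp_prime absvP).
rewrite (absv_fact_exp absvP) -{1}(prednK pm0) exprS mulfK //.
by rewrite expf_neq0 // gt_eqF.
Qed.

(** * Partial products and the dominant factor *)

Definition fprod J : {poly K} := \prod_(j < J) factor j.

(** Finitely many heights below [theta] have a common bound [h < theta]; the strict gap is what lets
    [F_N] dominate later. *)
Lemma fprod_before J : (J <= N)%N ->
  exists2 h, 0 <= h < t & bnd absv r h (fprod J - 1).
Proof.
elim: J => [_|J IHJ JN].
  exists 0; first by rewrite lexx.
  by rewrite /fprod big_ord0 subrr; apply: (bnd0 absvP).
have [h /andP[h0 ht1] hJ] := IHJ (ltnW JN).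
exists (Num.max h (ht J)).
  by rewrite le_max h0 gt_max ht1 ht_lt_before.
rewrite /fprod big_ord_recr /=; apply: (bnd_unitM absvP) => //.
- rewrite le_max h0 ge_max (le_trans (ltW ht1) (ltW t_lt1)) /=.
  exact: le_trans (ht_le J) (ltW t_lt1).
- by apply: bndW hJ => //; rewrite le_max lexx.
by apply: bndW (bnd_factor J) => //; rewrite le_max lexx orbT.
Qed.

(** The factors other than [F_N] all have height below [theta], and multiplying by them preserves
    the strict gap. *)
Lemma fprod_after J : (N < J)%N ->
  exists2 h, 0 <= h < t & bnd absv r h (fprod J - factor N).
Proof.
elim: J => // J IHJ; rewrite ltnS leq_eqVlt => /orP[/eqP NJ|NJ].
  have [h /andP[h0 ht1] hN] := fprod_before (leqnn N).
  exists h; first by rewrite h0.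
  rewrite -NJ /fprod big_ord_recr /= -{2}[factor N]mul1r -mulrBl -(mulr1 h).
  by apply: (bndM absvP) => //; apply: bnd1_factor.
have [h /andP[h0 ht1] hJ] := IHJ NJ.
exists (Num.max h (ht J)).
  by rewrite le_max h0 gt_max ht1 ht_lt // gtn_eqF.
rewrite /fprod big_ord_recr /=.
have -> : \prod_(i < J) factor i * factor J - factor N =
    (fprod J - factor N) * factor J + factor N * (factor J - 1).
  by rewrite /fprod; ring.
have hm0 : 0 <= Num.max h (ht J) by rewrite le_max h0.
apply: (bndD absvP).
  rewrite -(mulr1 (Num.max _ _)); apply: (bndM absvP) => //.
    by apply: bndW hJ => //; rewrite le_max lexx.
  exact: bnd1_factor.
rewrite -(mul1r (Num.max _ _)); apply: (bndM absvP) => //.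
  exact: bnd1_factor.
by apply: bndW (bnd_factor J) => //; rewrite le_max lexx orbT.
Qed.

(** * Identification of the truncated series with a partial product *)

Variable b : nat -> K.
Hypothesis b_eq : bottcher_eq d c b.
Let w := trunc (one_plus b) M.

(** Each [x^(nd) (1 + c x)^(n+1)] is [(1 + c x)] times the [n]-th power of [gmap], so the right-hand
    side of [bottcher_eq] factors. *)
Lemma trunc_eq : eqm M.+1 (w ^+ d) ((1 + c *: 'X) * (w \Po gmap)).
Proof.
apply/eqmP => k kM; rewrite (b_eq (kM : (k <= M)%N)).
congr ((_ : {poly K})`_k); rewrite /w /trunc comp_poly_def big_ord_recl /= expr0.
rewrite scale1r mulrDr mulr1; congr (_ + _).
rewrite big_add1 big_mkord mulr_sumr; apply: eq_bigr => i _.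
rewrite /gmap exprMn -exprM -scalerAr [RHS]scalerAr.
by rewrite mulnC exprS -scalerAr mulrCA scalerAr.
Qed.

Lemma coef0_comp_giter (f : {poly K}) j : (f \Po (c *: giter j))`_0 = f`_0.
Proof.
have /dvdpP[q ->] := giter_dvdX j.
by rewrite -!horner_coef0 horner_comp hornerZ hornerMX !mulr0.
Qed.

Lemma factorX j : eqm M.+1 (factor j ^+ (d ^ j.+1)) (1 + c *: giter j).
Proof.
have -> : factor j ^+ (d ^ j.+1) =
    (root_poly K (d ^ j.+1) M ^+ (d ^ j.+1)) \Po (c *: giter j).
  by rewrite /factor rmorphXn.
have -> : 1 + c *: giter j = (1 + 'X) \Po (c *: giter j).
  by rewrite comp_polyD comp_polyX -[1]/(1%:P) comp_polyC.
apply: eqm_comp; first by rewrite -mul_polyC dvdp_mull // giter_dvdX.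
apply: root_polyX; last by rewrite expn_gt0 d_gt0.
exact: (Cp_nat_neq0 absvP).
Qed.

(** Taking [d]-th powers and substituting [g^J] into [trunc_eq] produces a new factor [1 + c g^J],
    which [factorX] identifies with [F_J^(d^(J+1))]. *)
Lemma trunc_iter J :
  eqm M.+1 (w ^+ (d ^ J)) (fprod J ^+ (d ^ J) * (w \Po giter J)).
Proof.
elim: J => [|J IHJ] /=.
  by rewrite !expr1 /fprod big_ord0 mul1r comp_polyXr eqm_refl.
rewrite {1}expnSr exprM; apply: eqm_trans (eqmX d IHJ) _.
rewrite exprMn -exprM -expnSr {2}/fprod big_ord_recr /= exprMn -/(fprod J) -mulrA.
apply: eqmM; first exact: eqm_refl.
have -> : (w \Po giter J) ^+ d = (w ^+ d) \Po giter J by rewrite rmorphXn.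
apply: eqm_trans (eqm_comp (giter_dvdX J) trunc_eq) _.
rewrite comp_polyM comp_polyA comp_polyD comp_polyZ comp_polyX.
rewrite -[1]/(1%:P) comp_polyC; apply: eqmM; last exact: eqm_refl.
by apply: eqm_sym; apply: factorX.
Qed.

(** [X^(d^J)] divides [g^J] and [d^J > M], so [w(g^J)] in [trunc_iter] is 1 modulo [X^(M+1)];
    [eqm_root] then removes the power [d^J]. *)
Lemma trunc_fprod J : (M < J)%N -> eqm M.+1 w (fprod J).
Proof.
move=> MJ; have dJ0 : (0 < d ^ J)%N by rewrite expn_gt0 d_gt0.
apply: (@eqm_root _ _ (d ^ J)).
- exact: (Cp_nat_neq0 absvP).
- by rewrite coef_poly.
- rewrite -horner_coef0 horner_prod big1 // => j _.
  by rewrite horner_coef0 coef0_comp_giter coef_poly binom_root0.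
apply: eqm_trans (trunc_iter J) _.
rewrite -[X in eqm _ _ X]mulr1; apply: eqmM; first exact: eqm_refl.
have : eqm 1 w 1 by apply/eqmP; case=> // _; rewrite coef1 coef_poly.
rewrite /eqm expr1 => /dvdpP[q wq].
have -> : (w \Po giter J) - 1 = (w - 1) \Po giter J.
  by rewrite comp_polyB -[1]/(1%:P) comp_polyC.
rewrite wq comp_polyM comp_polyX; apply: dvdp_mull.
rewrite giterE; apply: dvdp_mulr; apply: dvdp_exp2l.
by apply: leq_trans MJ (ltnW (ltn_expl _ d_gt1)).
Qed.

End Coefficients.

(** * Bounds for the coefficients [b_n] *)

Section Bounds.
Variables (R : realType) (K : fieldType) (p : nat) (absv : K -> R).
Hypothesis absvP : Cp_abs p absv.
Variables (N d : nat) (c : K) (r : R) (b : nat -> K).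
Let A := absv d%:R.
Let t := theta R p.
Hypothesis d_gt1 : (1 < d)%N.
Hypothesis p_dvd_d : (p %| d)%N.
Hypothesis r_gt1 : 1 < r.
Hypothesis absv_c : absv c = t * r ^+ (d ^ N) * A ^+ N.+1.
Hypothesis r_lower : 1 < A * r ^+ (d ^ N * d.-1).
Hypothesis r_upper : N = 0%N \/ A * r ^+ (d ^ N.-1 * d.-1) < 1.
Hypothesis c_lt_r : absv c < r.
Hypothesis b_eq : bottcher_eq d c b.

Let r_gt0 : 0 < r := lt_trans ltr01 r_gt1.
Let t_gt0 : 0 < t := theta_gt0 absvP.

Lemma coef_bottcher M J n : (N < J)%N -> (M < J)%N -> (0 < n <= M)%N ->
  exists2 h, 0 <= h < t &
    absv (b n - (factor d c M N)`_n) <= h * r ^+ n.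
Proof.
move=> NJ MJ /andP[n0 nM].
have [h h01 hJ] := fprod_after absvP d_gt1 p_dvd_d r_gt1 absv_c r_lower
  r_upper c_lt_r M NJ.
exists h => //; move: (hJ n); rewrite coefB.
have /eqmP/(_ n nM) := trunc_fprod absvP d_gt1 b_eq MJ.
by rewrite coef_poly ltnS nM /one_plus gtn_eqF // => ->.
Qed.

Lemma bottcher_coef_le n : (0 < n)%N -> absv (b n) <= t * r ^+ n.
Proof.
(* [J] has to exceed both [N] and the truncation order, here [M = n]. *)
move=> n0; have [h /andP[h0 ht1] hb] := coef_bottcher (J := (N + n).+1)
  (leq_addr n N) (leq_addl N n) (introT andP (conj n0 (leqnn n))).
rewrite -(subrK (factor d c n N)`_n (b n)); apply: (absvD_le absvP).
  apply: le_trans hb _.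
  by rewrite ler_wpM2r ?(ltW ht1) // exprn_ge0 // ltW.
have := bnd_factor absvP d_gt1 p_dvd_d r_gt1 absv_c r_lower r_upper c_lt_r n N n.
by rewrite coefB coef1 gtn_eqF // subr0 (htN absvP d_gt1 r_gt1 absv_c).
Qed.

Lemma bottcher_coef_eq m :
  absv (b (d ^ N * p ^ m)) = t * r ^+ (d ^ N * p ^ m).
Proof.
set n := (d ^ N * p ^ m)%N.
have p_gt0 : (0 < p)%N by rewrite prime_gt0 // (Cp_prime absvP).
have n0 : (0 < n)%N by rewrite muln_gt0 !expn_gt0 p_gt0 ltnW.
have pn : (p ^ m <= n)%N by rewrite leq_pmull // expn_gt0 ltnW.
have [h /andP[h0 ht1] hb] := coef_bottcher (J := (N + n).+1)
  (leq_addr n N) (leq_addl N n) (introT andP (conj n0 (leqnn n))).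
have lead := absv_factor_lead absvP d_gt1 p_dvd_d r_gt1 absv_c pn.
have err := bnd_factor_lead absvP d_gt1 p_dvd_d r_gt1 absv_c r_lower r_upper
  c_lt_r n n.
rewrite coefB -/t in err; rewrite -/n -/t in lead.
move: hb lead err; set F := (factor d c n N)`_n.
set L := (factor_lead N d c n)`_n => hb lead err.
(* [|L|] is exactly [t r^n], and both corrections are strictly smaller. *)
have -> : b n = L + ((b n - F) + (F - L)) by ring.
rewrite (absvD_dom absvP) lead //; apply: (absvD_lt absvP).
  by apply: le_lt_trans hb _; rewrite ltr_pM2r // exprn_gt0.
apply: le_lt_trans err _; rewrite ltr_pM2r ?exprn_gt0 //.
by rewrite gtr_pMr // ltr_pdivrMr // mul1r.
Qed.

End Bounds.

(** * Radius of convergence and isometry *)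

Section Geometric.
Variable R : realType.

Lemma expr_unbounded (q C : R) : 1 < q ->
  exists n0, forall n, (n0 <= n)%N -> C < q ^+ n.
Proof.
move=> q1; have q10 : 0 < q - 1 by rewrite subr_gt0.
have bern n : 1 + n%:R * (q - 1) <= q ^+ n.
  elim: n => [|n IHn]; first by rewrite mul0r addr0 expr0.
  rewrite exprSr; apply: (@le_trans _ _ ((1 + n%:R * (q - 1)) * q)).
    rewrite -subr_ge0 -natr1.
    have -> : (1 + n%:R * (q - 1)) * q - (1 + (n%:R + 1) * (q - 1)) =
      n%:R * (q - 1) ^+ 2 by ring.
    by rewrite mulr_ge0 ?ler0n // sqr_ge0.
  by rewrite ler_wpM2r // ltW // (lt_trans ltr01).
exists (Num.bound (`|C| / (q - 1))) => n n0n.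
apply: le_lt_trans (ler_norm C) _; apply: lt_le_trans (bern n).
have Cn : `|C| / (q - 1) < n%:R.
  apply: lt_le_trans (archi_boundP (divr_ge0 (normr_ge0 C) (ltW q10))) _.
  by rewrite ler_nat.
by rewrite ltr_pdivrMr // in Cn; apply: lt_trans Cn _; rewrite ltrDr.
Qed.

Lemma expr_small (q eps : R) : 0 <= q < 1 -> 0 < eps ->
  exists n0, forall n, (n0 <= n)%N -> q ^+ n < eps.
Proof.
(* [q] may be 0, so a larger [q'] that is still below 1 is inverted instead. *)
move=> /andP[q0 q1] e0; pose q' := (q + 1) / 2.
have qq' : q <= q' by rewrite /q'; lra.
have q'0 : 0 < q' by rewrite /q'; lra.
have q'1 : 1 < q'^-1 by rewrite invf_gt1 // /q'; lra.
have [n0 hn0] := expr_unbounded eps^-1 q'1.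
exists n0 => n /hn0; rewrite exprVn ltf_pV2 ?posrE ?exprn_gt0 //.
by apply: le_lt_trans; rewrite lerXn2r ?nnegrE // ltW.
Qed.

End Geometric.

(** * Limits in a complete ultrametric field *)

Section Series.
Variables (R : realType) (K : fieldType) (p : nat) (absv : K -> R).
Hypothesis absvP : Cp_abs p absv.

Definition seq_lim (u : nat -> K) l := forall eps, 0 < eps ->
  exists M, forall m, (M <= m)%N -> absv (u m - l) < eps.

(** Along a sequence with nonzero limit, ultrametric absolute values are eventually constant. *)
Lemma seq_lim_le u l h : seq_lim u l ->
  (exists M, forall m, (M <= m)%N -> absv (u m) <= h) -> absv l <= h.
Proof.
move=> ul [M uh]; rewrite leNgt; apply/negP => hl.
have l0 : 0 < absv l.
  by apply: le_lt_trans hl; apply: le_trans (absv_ge0 absvP _) (uh M _).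
have [M' uM'] := ul _ l0; pose m := maxn M M'.
have := uM' m (leq_maxr _ _); have := uh m (leq_maxl _ _) => um ulm.
suff : absv (u m) = absv l by move=> uml; rewrite uml leNgt hl in um.
by rewrite -{1}(subrK l (u m)) addrC (absvD_dom absvP).
Qed.

Lemma seq_limB u v l l' : seq_lim u l -> seq_lim v l' ->
  seq_lim (fun n => u n - v n) (l - l').
Proof.
move=> ul vl eps e0; have [M hM] := ul _ e0; have [M' hM'] := vl _ e0.
exists (maxn M M') => m; rewrite geq_max => /andP[/hM h /hM' h'].
have -> : u m - v m - (l - l') = (u m - l) - (v m - l') by ring.
exact: (absvB_lt absvP).
Qed.

Lemma seq_lim_cst (x : K) : seq_lim (fun=> x) x.
Proof. by move=> eps e0; exists 0%N => m _; rewrite subrr (absv0 absvP). Qed.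

(** By the ultrametric inequality, small consecutive differences already make a sequence Cauchy. *)
Lemma seq_lim_ex u :
  (forall eps, 0 < eps ->
     exists M, forall m, (M <= m)%N -> absv (u m.+1 - u m) < eps) ->
  exists l, seq_lim u l.
Proof.
move=> small; apply: (Cp_complete absvP) => eps e0.
have [M hM] := small _ e0; exists M => m n Mm Mn.
have far k : absv (u (M + k)%N - u M) < eps.
  elim: k => [|k IHk]; first by rewrite addn0 subrr (absv0 absvP).
  rewrite addnS -(subrKA (u (M + k)%N)); apply: (absvD_lt absvP) => //.
  by apply: hM; rewrite leq_addr.
have -> : u m - u n = (u m - u M) - (u n - u M) by ring.
by apply: (absvB_lt absvP); rewrite -(subnKC Mm, subnKC Mn).
Qed.

Lemma absv_subXX (x y : K) h n : absv x <= h -> absv y <= h ->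
  absv (x ^+ n.+1 - y ^+ n.+1) <= absv (x - y) * h ^+ n.
Proof.
move=> xh yh; have h0 := le_trans (absv_ge0 absvP x) xh.
rewrite subrXX (absvM absvP) ler_wpM2l ?(absv_ge0 absvP) //.
apply: (absv_sum_le absvP) => [|i _]; first exact: exprn_ge0.
have -> : h ^+ n = h ^+ (n - i) * h ^+ i by rewrite -exprD subnK // -ltnS.
rewrite (absvM absvP) !(absvX absvP).
by rewrite ler_pM ?exprn_ge0 ?(absv_ge0 absvP) // lerXn2r ?nnegrE ?(absv_ge0 absvP).
Qed.

Lemma conv_radiusE (a : nat -> K) (r : R) : 0 < r ->
  (exists C, forall n, absv (a n) * r^-1 ^+ n <= C) ->
  (forall s C, r^-1 < s -> ~ (forall n, absv (a n) * s ^+ n <= C)) ->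
  conv_radius absv a = (r^-1)%:E.
Proof.
move=> r0 bounded unbounded; apply/eqP; rewrite eq_le; apply/andP; split.
  apply: ge_ereal_sup => _ [s [s0 [C sC]] <-].
  rewrite lee_fin leNgt; apply/negP => rs; exact: unbounded rs sC.
apply: ereal_sup_ubound; exists r^-1 => //; split => //.
by rewrite invr_ge0 ltW.
Qed.

(** * Coefficients of the inverse series *)

Section Inverse.
Variables (a e : nat -> K) (s t : R).
Hypothesis s_gt0 : 0 < s.
Hypothesis t_le1 : 0 <= t <= 1.
Hypotheses (a0 : a 0 = 0) (a1 : a 1 = 1) (e0 : e 0 = 0).
Hypothesis ae : forall m k, (k <= m)%N ->
  (trunc a m \Po trunc e m)`_k = (k == 1%N)%:R.
Hypothesis a_le : forall n, (0 < n)%N -> absv (a n.+1) <= t * s ^+ n.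

Lemma comp_inverse_coef1 : e 1 = 1.
Proof.
have := ae (leqnn 1); rewrite comp_poly_def coef_sum !big_ord_recl big_ord0 /=.
by rewrite !coefZ a0 mul0r add0r a1 mul1r addr0 expr1 coef_poly.
Qed.

(** Coefficient [n+1] of [a(e(x)) = x] expresses [e_(n+1)] through the [a_i] and the powers [e^i]
    with [i >= 2], which involve only [e_1, ..., e_n]. General [s] and [t <= 1] allow a second use
    with [a] and [e] exchanged. *)
Lemma comp_inverse_coef_le n : (0 < n)%N -> absv (e n.+1) <= t * s ^+ n.
Proof.
have /andP[t0 t1] := t_le1.
elim/ltn_ind: n => n IHn n0.
(* [Q] is [e / x]; [q] omits its top coefficient [e_(n+1)], which is not bounded yet. They agree
   below degree [n]. *)
pose q : {poly K} := \poly_(j < n) e j.+1.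
pose Q : {poly K} := \poly_(j < n.+1) e j.+1.
have bq : bnd absv s 1 q.
  move=> j; rewrite coef_poly mul1r; case: ltnP => jn; last first.
    by rewrite (absv0 absvP) exprn_ge0 // ltW.
  have [->|j0] := posnP j; first by rewrite comp_inverse_coef1 (absv1 absvP).
  apply: le_trans (IHn j jn j0) _.
  by rewrite ler_piMl // exprn_ge0 // ltW.
have EQ : trunc e n.+1 = 'X * Q.
  apply/polyP => -[|j]; rewrite coef_poly coefXM //=.
  by rewrite coef_poly ltnS.
have := ae (leqnn n.+1); rewrite comp_poly_def coef_sum !big_ord_recl /= a0.
rewrite scale0r coef0 add0r a1 scale1r expr1 coef_poly ltnS leqnn.
rewrite eqSS gtn_eqF // => /eqP; rewrite addr_eq0 => /eqP ->.
rewrite (absvN absvP); apply: (absv_sum_le absvP) => [|i _].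
  by rewrite mulr_ge0 // exprn_ge0 // ltW.
rewrite coefZ (absvM absvP) EQ exprMn coefXnM /bump /= !add1n.
have ni : (n.+1 < i.+2)%N = false by rewrite ltnNge ltnS ltn_ord.
rewrite ni subSS.
have lt_n : (n - i.+1 < n)%N by rewrite ltn_subrL n0.
have /eqmP/(_ _ lt_n) -> : eqm n (Q ^+ i.+2) (q ^+ i.+2).
  apply: eqmX; apply/eqmP => j jn.
  by rewrite !coef_poly jn ltnS (ltnW jn).
apply: (@le_trans _ _ ((t * s ^+ i.+1) * s ^+ (n - i.+1))).
  rewrite ler_pM ?(absv_ge0 absvP) ?a_le //.
  have qX : bnd absv s 1 (q ^+ i.+2) by apply: (bnd_exp absvP).
  by have := qX (n - i.+1)%N; rewrite mul1r.
by rewrite -mulrA -exprD subnKC.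
Qed.

End Inverse.

(** * Radii of convergence of a series and its inverse *)

Section Radius.
Variables (a e : nat -> K) (r t : R).
Hypothesis r_gt0 : 0 < r.
Hypothesis t_gt0 : 0 < t.
Hypothesis t_lt1 : t < 1.
Hypotheses (a0 : a 0 = 0) (a1 : a 1 = 1).
Hypothesis ae : comp_inverse a e.
Hypothesis a_le : forall n, (0 < n)%N -> absv (a n.+1) <= t * r ^+ n.
Hypothesis a_eq : forall n0, exists2 n, (n0 <= n)%N & absv (a n.+1) = t * r ^+ n.

Lemma coef_bounded (u : nat -> K) : u 0 = 0 -> u 1 = 1 ->
  (forall n, (0 < n)%N -> absv (u n.+1) <= t * r ^+ n) ->
  exists C, forall n, absv (u n) * r^-1 ^+ n <= C.
Proof.
move=> u0 u1 u_le; exists r^-1 => -[|n].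
  by rewrite u0 (absv0 absvP) mul0r invr_ge0 ltW.
rewrite exprSr mulrA ler_piMl ?invr_ge0 ?(ltW r_gt0) // exprVn.
rewrite ler_pdivrMr ?exprn_gt0 // mul1r.
have [->|n0] := posnP n; first by rewrite u1 (absv1 absvP).
apply: le_trans (u_le n n0) _.
by rewrite ler_piMl ?(ltW t_lt1) // exprn_ge0 // ltW.
Qed.

Lemma coef_not_le (s C : R) : 0 < s -> s < r ->
  ~ (forall n, absv (a n.+1) <= C * s ^+ n).
Proof.
move=> s0 sr aC; have rs1 : 1 < r / s by rewrite ltr_pdivlMr // mul1r.
have [n0 hn0] := expr_unbounded (C / t) rs1.
have [n /hn0 Cn an] := a_eq n0.
have := aC n; rewrite an leNgt => /negP; apply.
rewrite -ltr_pdivlMr ?exprn_gt0 // -mulrA -expr_div_n mulrC.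
by rewrite -ltr_pdivrMr.
Qed.

Lemma conv_radius_series : conv_radius absv a = (r^-1)%:E.
Proof.
apply: conv_radiusE => //; first exact: coef_bounded.
move=> s C rs aC; have s0 : 0 < s by apply: lt_trans rs; rewrite invr_gt0.
apply: (@coef_not_le s^-1 (C / s)).
- by rewrite invr_gt0.
- by rewrite -[r]invrK ltf_pV2 ?posrE // invr_gt0.
move=> n; rewrite -mulrA exprVn -invfM -exprS ler_pdivlMr ?exprn_gt0 //.
Qed.

(* A radius [> 1/r] for [e] gives [|e_(n+1)| <= B s^-n] with [s > 1/r];
   interpolating geometrically with [|e_(n+1)| <= t r^n] absorbs [B] into a
   power of [t], so [|e_(n+1)| <= q^n] with [q < r], and inversion returns this
   bound to [a]. *)
Lemma conv_radius_inverse : conv_radius absv e = (r^-1)%:E.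
Proof.
have [e0 [aeE eaE]] := ae; have t01 : 0 <= t <= 1 by rewrite !ltW.
have e1 := comp_inverse_coef1 a0 a1 aeE.
have e_le := comp_inverse_coef_le r_gt0 t01 a0 a1 e0 aeE a_le.
apply: conv_radiusE => //; first exact: coef_bounded.
move=> s C rs eC; have s0 : 0 < s by apply: lt_trans rs; rewrite invr_gt0.
have [l hl] : exists l, C / s < t^-1 ^+ l.
  have t1 : 1 < t^-1 by rewrite invf_gt1.
  by have [l hl] := expr_unbounded (C / s) t1; exists l; apply: hl.
(* The geometric mean of [r] and [1/s] with weights [l] and 1; it is below [r] since [1/s < r]. *)
pose q := (r ^+ l / s) `^ (l.+1%:R)^-1.
have rls0 : 0 < r ^+ l / s by rewrite divr_gt0 ?exprn_gt0.
have q0 : 0 < q by rewrite powR_gt0.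
have qE : q ^+ l.+1 = r ^+ l / s.
  by rewrite -powR_mulrn ?powR_ge0 // -powRrM mulVf ?powRr1 ?pnatr_eq0 // ltW.
have qr : q < r.
  rewrite -(@ltr_pXn2r _ l.+1) ?nnegrE ?ltW // qE exprSr.
  by rewrite ltr_pM2l ?exprn_gt0 // -[r]invrK ltf_pV2 ?posrE // invr_gt0.
have e_q n : (0 < n)%N -> absv (e n.+1) <= 1 * q ^+ n.
  move=> n0; have en0 := absv_ge0 absvP (e n.+1).
  rewrite mul1r -(@ler_pXn2r _ l.+1) ?nnegrE ?exprn_ge0 ?(ltW q0) //.
  rewrite -exprM mulnC exprM qE expr_div_n exprSr.
  have en : absv (e n.+1) <= C / s / s ^+ n.
    by rewrite -mulrA -invfM -exprS ler_pdivlMr ?exprn_gt0.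
  apply: (@le_trans _ _ ((t * r ^+ n) ^+ l * (C / s / s ^+ n))).
    rewrite ler_pM ?exprn_ge0 // lerXn2r ?nnegrE ?e_le //.
    by rewrite mulr_ge0 ?exprn_ge0 // ltW.
  have -> : (t * r ^+ n) ^+ l * (C / s / s ^+ n) =
      (C / s * t ^+ l) * ((r ^+ l) ^+ n / s ^+ n).
    by rewrite exprMn -!exprM [(n * l)%N]mulnC; ring.
  rewrite ler_piMl ?divr_ge0 ?exprn_ge0 ?(ltW s0) ?(ltW r_gt0) //.
  by rewrite -ler_pdivlMr ?exprn_gt0 // mul1r -exprVn ltW.
have a_q := comp_inverse_coef_le q0 (introT andP (conj ler01 (lexx 1)))
  e0 e1 a0 eaE e_q.
apply: (@coef_not_le q 1) => // -[|n]; last exact: a_q.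
by rewrite a1 (absv1 absvP) expr0 mulr1.
Qed.

End Radius.

(** * The isometry defined by the series *)

Section Isometry.
Variables (a : nat -> K) (r t : R).
Hypothesis r_gt0 : 0 < r.
Hypothesis t_gt0 : 0 < t.
Hypothesis t_lt1 : t < 1.
Hypotheses (a0 : a 0 = 0) (a1 : a 1 = 1).
Hypothesis a_le : forall n, (0 < n)%N -> absv (a n.+1) <= t * r ^+ n.

Let S (x : K) m := \sum_(i < m) a i * x ^+ i.

(** The terms of degree 0 and 1 give the identity, hence the offset [m.+2]; in degree [n+1] the
    factor [t] comes from [|a_(n+1)| r^(-n) <= t]. *)
Lemma partial_sum_sub x y m : absv x < r^-1 -> absv y < r^-1 ->
  absv (S x m.+2 - S y m.+2 - (x - y)) <= t * absv (x - y).
Proof.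
move=> xr yr; rewrite /S !big_ord_recl /= a0 !mul0r !add0r a1 !mul1r !expr1.
rewrite [X in absv X](_ : _ = \sum_(i < m) a (bump 0 (bump 0 i)) *
  x ^+ bump 0 (bump 0 i) - \sum_(i < m) a (bump 0 (bump 0 i)) *
  y ^+ bump 0 (bump 0 i)); last by ring.
rewrite -sumrB.
apply: (absv_sum_le absvP) => [|i _].
  by rewrite mulr_ge0 ?(ltW t_gt0) ?(absv_ge0 absvP).
rewrite /bump /= !add1n -mulrBr (absvM absvP).
have := absv_subXX i.+1 (ltW xr) (ltW yr) => xy.
apply: (@le_trans _ _ ((t * r ^+ i.+1) * (absv (x - y) * r^-1 ^+ i.+1))).
  by rewrite ler_pM ?(absv_ge0 absvP) ?a_le.
by rewrite mulrACA exprVn mulfV ?mulr1 // expf_neq0 // gt_eqF.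
Qed.

(** The term of degree [k+2] is at most [(r |x|)^(k+1) |x|], and [r |x| < 1]. *)
Lemma series_conv_ex x : absv x < r^-1 ->
  exists l, series_conv_to absv a x l.
Proof.
move=> xr; have x0 := absv_ge0 absvP x.
have q01 : 0 <= r * absv x < 1.
  by rewrite mulr_ge0 ?(ltW r_gt0) //= mulrC -ltr_pdivlMr // mul1r.
apply: seq_lim_ex => eps eps0.
have [n0 hn0] := expr_small q01 (mulr_gt0 eps0 r_gt0).
exists n0.+2 => -[|[|k]] // n0k.
rewrite big_ord_recr /= addrAC subrr add0r (absvM absvP) (absvX absvP).
apply: (@le_lt_trans _ _ (r ^+ k.+1 * absv x ^+ k.+2)).
  rewrite ler_wpM2r ?exprn_ge0 //; apply: le_trans (a_le _) _ => //.
  by rewrite ler_piMl ?(ltW t_lt1) // exprn_ge0 // ltW.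
rewrite [absv x ^+ k.+2]exprSr mulrA -exprMn.
apply: (@le_lt_trans _ _ ((r * absv x) ^+ k.+1 * r^-1)).
  by rewrite ler_wpM2l ?(ltW xr) // exprn_ge0 //; case/andP: q01.
by rewrite ltr_pdivrMr // hn0 // ltnW.
Qed.

Lemma isometry_onto : exists f : K -> K,
  (forall x, absv x < r^-1 -> series_conv_to absv a x (f x)) /\
  (forall x, absv x < r^-1 -> absv (f x) < r^-1) /\
  (forall x y, absv x < r^-1 -> absv y < r^-1 ->
     absv (f x - f y) = absv (x - y)) /\
  (forall y, absv y < r^-1 -> exists2 x, absv x < r^-1 & f x = y).
Proof.
have [f fP] : exists f : K -> K,
    forall x, absv x < r^-1 -> series_conv_to absv a x (f x).
  have /choice[f fP] : forall x, exists l,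
      absv x < r^-1 -> series_conv_to absv a x l.
    (* The value 0 outside the disk only makes [f] total. *)
    move=> x; have [xr|xr] := boolP (absv x < r^-1); last by exists 0.
    by have [l xl] := series_conv_ex xr; exists l.
  by exists f.
have r0 : absv 0 < r^-1 by rewrite (absv0 absvP) invr_gt0.
(* In the limit, [f] minus the identity is a [t]-contraction; isometry and surjectivity both rest on
   this. *)
have f_sub x y : absv x < r^-1 -> absv y < r^-1 ->
    absv (f x - f y - (x - y)) <= t * absv (x - y).
  move=> xr yr; pose u m := S x m - S y m - (x - y).
  apply: (@seq_lim_le u).
    apply: seq_limB; last exact: seq_lim_cst.
    by apply: seq_limB; apply: fP.
  by exists 2%N => -[|[|m]] // _; apply: partial_sum_sub.
have f_iso x y : absv x < r^-1 -> absv y < r^-1 ->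
    absv (f x - f y) = absv (x - y).
  move=> xr yr; have [->|xy] := eqVneq x y; first by rewrite !subrr.
  have -> : f x - f y = (x - y) + (f x - f y - (x - y)) by ring.
  rewrite (absvD_dom absvP) //; apply: le_lt_trans (f_sub x y xr yr) _.
  by rewrite gtr_pMl // (absv_gt0 absvP) subr_eq0.
have f0 : f 0 = 0.
  apply/eqP; rewrite -(absv_eq0 absvP) eq_le (absv_ge0 absvP) andbT.
  apply: (seq_lim_le (fP 0 r0)); exists 0%N => m _.
  rewrite big1 ?(absv0 absvP) // => -[[|i] im] _ /=; first by rewrite a0 mul0r.
  by rewrite expr0n mulr0.
have f_abs x : absv x < r^-1 -> absv (f x) = absv x.
  by move=> xr; have := f_iso x 0 xr r0; rewrite f0 !subr0.
exists f; split=> //; split; first by move=> x xr; rewrite f_abs.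
split=> // y yr.
(* Banach iteration of [x -> y - (f x - x)], whose fixed points solve [f x = y]. *)
pose u := fix u n := if n is n'.+1 then y - (f (u n') - u n') else 0.
have u_le n : absv (u n) <= absv y.
  elim: n => [|n IHn] /=; first by rewrite (absv0 absvP) (absv_ge0 absvP).
  apply: (absvB_le absvP) => //.
  have := f_sub (u n) 0 (le_lt_trans IHn yr) r0; rewrite f0 !subr0 => fu.
  apply: le_trans fu _; apply: le_trans IHn.
  by rewrite ler_piMl ?(absv_ge0 absvP) // ltW.
have u_lt n : absv (u n) < r^-1 := le_lt_trans (u_le n) yr.
have u_step n : absv (u n.+1 - u n) <= t ^+ n * r^-1.
  elim: n => [|n IHn].
    by rewrite expr0 mul1r subr0; apply: le_trans (u_le 1%N) (ltW yr).
  have -> : u n.+2 - u n.+1 = - (f (u n.+1) - f (u n) - (u n.+1 - u n)).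
    by rewrite /=; ring.
  rewrite (absvN absvP) exprS -mulrA; apply: le_trans (f_sub _ _ _ _) _ => //.
  by rewrite ler_pM2l.
have [x ux] : exists x, seq_lim u x.
  apply: seq_lim_ex => eps eps0.
  have t01 : 0 <= t < 1 by rewrite ltW.
  have [n0 hn0] := expr_small t01 (mulr_gt0 eps0 r_gt0).
  exists n0 => m /hn0 tm; apply: le_lt_trans (u_step m) _.
  by rewrite ltr_pdivrMr.
have xr : absv x < r^-1.
  by apply: le_lt_trans yr; apply: (seq_lim_le ux); exists 0%N.
exists x => //; apply/eqP; rewrite -subr_eq0 -(absv_eq0 absvP).
rewrite eq_le (absv_ge0 absvP) andbT leNgt; apply/negP => fxy.
have [n0 hn0] := ux _ fxy.
suff : absv (f x - y) < absv (f x - y) by rewrite ltxx.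
(* If [f x] differed from [y], both terms on the right would be smaller than [|f x - y|] by the
   choice of [n0]. *)
have dec : f x - y = (f x - f (u n0) - (x - u n0)) - (u n0.+1 - x).
  by rewrite /=; ring.
rewrite {1}dec.
apply: (absvB_lt absvP); last exact: (hn0 _ (leqnSn _)).
apply: le_lt_trans (f_sub _ _ _ _) _ => //.
apply: le_lt_trans (hn0 n0 (leqnn _)).
by rewrite (absvBC absvP) // ler_piMl ?(absv_ge0 absvP) // ltW.
Qed.

End Isometry.
End Series.

(** * Consequences of Conditions A and B *)

Section RadiusBounds.
Variables (R : realType) (K : fieldType) (p : nat) (absv : K -> R).
Hypothesis absvP : Cp_abs p absv.
Variables (N d : nat) (c : K).
Let A := absv d%:R.
Let t := theta R p.
Let F := absv d.-1`!%:R.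
Let r := rN p absv N d c.
Hypothesis d_gt1 : (1 < d)%N.
Hypothesis c_neq0 : c != 0.

Let t_gt0 : 0 < t := theta_gt0 absvP.
Let t_lt1 : t < 1 := theta_lt1 absvP.
Let d_gt0 : (0 < d)%N := ltnW d_gt1.
Let k_gt0 : (0 < d.-1)%N. Proof. by rewrite -ltnS prednK. Qed.
Let A_gt0 : 0 < A.
Proof. by rewrite (absv_gt0 absvP) (Cp_nat_neq0 absvP). Qed.
Let F_gt0 : 0 < F.
Proof. by rewrite (absv_gt0 absvP) (Cp_nat_neq0 absvP) ?fact_gt0. Qed.
Let C_gt0 : 0 < absv c.
Proof. by rewrite (absv_gt0 absvP). Qed.

(** Clears the logarithms: the bounds on [v_p(c)] become comparisons of [(|c| / A^j)^(d-1)] with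
    [F], at [j = N] for the lower and [j = N+1] for the upper bound. *)
Lemma vp_gap j :
  j%:R * vp p absv d%:R + vp p absv d.-1`!%:R / d.-1%:R - vp p absv c =
  (ln ((absv c / A ^+ j) ^+ d.-1) - ln F) / (ln p%:R * d.-1%:R).
Proof.
have ln_p : ln p%:R != 0 :> R by rewrite gt_eqF // ln_gt0 // (p_gt1R absvP).
have kR : d.-1%:R != 0 :> R by rewrite pnatr_eq0 -lt0n.
rewrite /vp -/A -/F lnXn ?divr_gt0 ?exprn_gt0 //.
rewrite lnM ?posrE ?invr_gt0 ?exprn_gt0 // lnV ?posrE ?exprn_gt0 // lnXn //.
rewrite -[ln A *+ j]mulr_natl -[_ *+ d.-1]mulr_natl; field.
by rewrite ln_p kR.
Qed.

Let gap_den : 0 < (ln p%:R * d.-1%:R)^-1 :> R.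
Proof. by rewrite invr_gt0 mulr_gt0 ?ltr0n // ln_gt0 // (p_gt1R absvP). Qed.

Lemma vp_lt j :
  vp p absv c < j%:R * vp p absv d%:R + vp p absv d.-1`!%:R / d.-1%:R ->
  F < (absv c / A ^+ j) ^+ d.-1.
Proof.
rewrite -subr_gt0 vp_gap pmulr_lgt0 // subr_gt0.
by rewrite ltr_ln // posrE ?exprn_gt0 ?divr_gt0 ?exprn_gt0.
Qed.

Lemma vp_gt j :
  j%:R * vp p absv d%:R + vp p absv d.-1`!%:R / d.-1%:R < vp p absv c ->
  (absv c / A ^+ j) ^+ d.-1 < F.
Proof.
rewrite -subr_lt0 vp_gap pmulr_llt0 // subr_lt0.
by rewrite ltr_ln // posrE ?exprn_gt0 ?divr_gt0 ?exprn_gt0.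
Qed.

Lemma rN_gt0 : 0 < r.
Proof.
rewrite /r /rN powR_gt0 // mulr_gt0 //.
  rewrite (absvM absvP) (absvV absvP) (absvX absvP) divr_gt0 //.
  exact: exprn_gt0.
by have := t_gt0; rewrite invr_gt0.
Qed.

Lemma rN_absv_c : absv c = t * r ^+ (d ^ N) * A ^+ N.+1.
Proof.
have -> : r ^+ (d ^ N) = absv c / A ^+ N.+1 / t.
  have -> : r = (absv c / A ^+ N.+1 / t) `^ ((d ^ N)%:R)^-1.
    by rewrite /r /rN (absvM absvP) (absvV absvP) (absvX absvP) /t /theta invrK.
  rewrite -powR_mulrn ?powR_ge0 // -powRrM mulVf ?powRr1 ?ltW ?divr_gt0 ?exprn_gt0 //.
  by rewrite pnatr_eq0 expn_eq0 -leqn0 leqNgt d_gt0.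
by field; rewrite expf_neq0 ?gt_eqF.
Qed.

(* [F = |(d-1)!|] and [F A = |d!|]; for [d] a power of [p] this is an equality,
   which is what [rN_upper] needs. *)
Lemma fact_pred_ge : t ^+ d.-1 <= F * A.
Proof.
rewrite /F /A -(absvM absvP) -natrM mulnC -[X in (X * _)%N](prednK d_gt0) -factS.
by rewrite prednK //; apply: absv_fact_ge.
Qed.

(** [t^(d-1) <= F A < (t r^(d^N))^(d-1) A], and [t^(d-1)] cancels. *)
Lemma rN_lower :
  vp p absv c < N.+1%:R * vp p absv d%:R + vp p absv d.-1`!%:R / d.-1%:R ->
  1 < A * r ^+ (d ^ N * d.-1).
Proof.
move/vp_lt; have -> : absv c / A ^+ N.+1 = t * r ^+ (d ^ N).
  by rewrite rN_absv_c mulfK // expf_neq0 // gt_eqF.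
rewrite exprMn -exprM => lt_F.
rewrite -(ltr_pM2l (exprn_gt0 d.-1 t_gt0)) mulr1.
apply: le_lt_trans fact_pred_ge _.
by rewrite mulrCA [F * A]mulrC ltr_pM2l.
Qed.

Lemma rN_upper m : (0 < N)%N -> d = (p ^ m)%N ->
  N%:R * vp p absv d%:R + vp p absv d.-1`!%:R / d.-1%:R < vp p absv c ->
  A * r ^+ (d ^ N.-1 * d.-1) < 1.
Proof.
move=> N0 dE /vp_gt; have -> : absv c / A ^+ N = t * r ^+ (d ^ N) * A.
  by rewrite rN_absv_c exprS; field; rewrite expf_neq0 // gt_eqF.
have FA : F * A = t ^+ d.-1.
  rewrite /F /A -(absvM absvP) -natrM mulnC -[X in (X * _)%N](prednK d_gt0).
  by rewrite -factS prednK // dE (absv_fact_exp absvP).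
rewrite -(ltr_pM2r A_gt0) FA !exprMn -!mulrA gtr_pMr ?exprn_gt0 // => lt1.
(* [lt1] amounts to [A^d r^(d^N (d-1)) < 1], whose left side is the [d]-th power of the quantity to
   bound. *)
rewrite -(@ltr_pXn2r _ d) ?nnegrE ?mulr_ge0 ?exprn_ge0 ?(ltW A_gt0) ?ler01 //;
  last exact: ltW rN_gt0.
rewrite expr1n exprMn -exprM mulnAC -expnSr prednK // mulrC exprM.
by rewrite -[X in A ^+ X](prednK d_gt0) exprSr.
Qed.

Lemma rN_gt1 : 1 < A * r ^+ (d ^ N * d.-1) -> 1 < r.
Proof.
move=> lower; rewrite ltNge; apply/negP => r_le1; move: lower; apply/negP.
rewrite -leNgt mulr_ile1 ?(absv_ge0 absvP) ?(absv_nat_le1 absvP) //.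
  by rewrite exprn_ge0 // ltW // rN_gt0.
by rewrite exprn_ile1 // ltW // rN_gt0.
Qed.

End RadiusBounds.

(** Supplies the hypotheses of the coefficient estimates. Under A, [|c| = theta r A < r]; under B,
    [(|c| / A^N)^(d-1) < F <= 1] gives [|c| < 1 < r]. *)
Lemma cond_params (R : realType) (K : fieldType) (p : nat) (absv : K -> R)
    (N d : nat) (c : K) (r := rN p absv N d c) (A := absv d%:R) :
  Cp_abs p absv -> (1 < d)%N ->
  condA p absv N d c \/ condB p absv N d c ->
  [/\ c != 0, (p %| d)%N, 1 < A * r ^+ (d ^ N * d.-1),
    N = 0%N \/ A * r ^+ (d ^ N.-1 * d.-1) < 1 & absv c < r].
Proof.
move=> absvP d1; have d0 := ltnW d1.
have t0 := theta_gt0 absvP; have t1 := theta_lt1 absvP.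
have A0 : 0 < A by rewrite (absv_gt0 absvP) (Cp_nat_neq0 absvP).
have A_le1 : A <= 1 := absv_nat_le1 absvP d.
case=> [[N0 [pd [c0 lt_c]]]|[N1 [[m dE] [c0 [gt_c lt_c]]]]].
  subst N; have r0 := rN_gt0 absvP 0 d1 c0.
  split=> //; [|by left|].
    by apply: (rN_lower absvP) => //; rewrite mul1r.
  rewrite (rN_absv_c absvP 0 d1 c0) expn0 !expr1 mulrAC gtr_pMl //.
  by apply: le_lt_trans t1; rewrite ler_piMr // ltW.
have lower := rN_lower absvP d1 c0 lt_c.
split=> //.
- rewrite dE; case: m dE => [d_1|m _]; first by rewrite d_1 in d1.
  by rewrite expnS dvdn_mulr.
- by right; exact: (rN_upper absvP d1 c0 N1 dE gt_c).
apply: lt_trans (rN_gt1 absvP d1 c0 lower).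
have small : absv c / A ^+ N < 1.
  rewrite ltNge; apply/negP => /(exprn_ege1 d.-1); apply/negP; rewrite -ltNge.
  exact: lt_le_trans (vp_gt absvP d1 c0 gt_c) (absv_nat_le1 absvP _).
rewrite ltr_pdivrMr ?exprn_gt0 // mul1r in small.
by apply: lt_le_trans small _; rewrite exprn_ile1 // ltW.
Qed.

(** * Radii and isometry from the coefficient bounds *)

Unset Implicit Arguments. Set Strict Implicit.

Theorem theorem1p3 (R : realType) (K : closedFieldType) (p : nat)
  (absv : K -> R) (N d : nat) (c : K) (b e : nat -> K) :
  Cp_abs p absv ->
  (2 <= d)%N ->
  condA p absv N d c \/ condB p absv N d c ->
  bottcher_eq d c b ->
  comp_inverse (phi_coef b) e ->
  let r := rN p absv N d c in
  1 < r /\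
  conv_radius absv (phi_coef b) = (r^-1)%:E /\
  conv_radius absv e = (r^-1)%:E /\
  exists f : K -> K,
    (forall x, absv x < r^-1 -> series_conv_to absv (phi_coef b) x (f x)) /\
    (forall x, absv x < r^-1 -> absv (f x) < r^-1) /\
    (forall x y, absv x < r^-1 -> absv y < r^-1 ->
       absv (f x - f y) = absv (x - y)) /\
    (forall y, absv y < r^-1 -> exists2 x, absv x < r^-1 & f x = y).
Proof.
move=> absvP d1 cond b_eq inv r.
have [c0 pd lower upper c_lt_r] := cond_params absvP d1 cond.
have r1 : 1 < r := rN_gt1 absvP d1 c0 lower.
have r0 := lt_trans ltr01 r1.
have cE := rN_absv_c absvP N d1 c0.
have t0 := theta_gt0 absvP; have t1 := theta_lt1 absvP.
have a_le n : (0 < n)%N -> absv (phi_coef b n.+1) <= theta R p * r ^+ n.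
  move=> n0; rewrite /phi_coef /one_plus /= gtn_eqF //.
  exact: (bottcher_coef_le absvP d1 pd r1 cE lower upper c_lt_r b_eq n0).
(* The indices [d^N p^m] are unbounded in [m]; [m = n0] already passes [n0]. *)
have a_eq n0 : exists2 n, (n0 <= n)%N &
    absv (phi_coef b n.+1) = theta R p * r ^+ n.
  have p1 := prime_gt1 (Cp_prime absvP).
  have n_gt : (n0 < d ^ N * p ^ n0)%N.
    apply: leq_trans (ltn_expl n0 p1) _.
    by rewrite leq_pmull // expn_gt0 (ltnW d1).
  exists (d ^ N * p ^ n0)%N; first exact: ltnW.
  rewrite /phi_coef /one_plus /= gtn_eqF //; last exact: leq_ltn_trans n_gt.
  exact: (bottcher_coef_eq absvP d1 pd r1 cE lower upper c_lt_r b_eq n0).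
split=> //; split; first exact: (conv_radius_series absvP r0 t0 t1 _ _ a_le a_eq).
split; first exact: (conv_radius_inverse absvP r0 t0 t1 _ _ inv a_le a_eq).
(* Injectivity is contained in the isometry, so surjectivity completes bijectivity. *)
exact: (isometry_onto absvP r0 t0 t1 _ _ a_le).
Qed.
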